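(* Let $q$ be even. Rank-1 nets of conics in $\mathrm{PG}(2,q)$ do not correspond to planes of $\mathrm{PG}(5,q)$ having at least one rank-1 point: under the bijection sending a plane $\pi$ of $\mathrm{PG}(5,q)$ to its associated net of conics $\mathcal{N}_\pi$ in $\mathrm{PG}(2,q)$, it is not true that $\pi$ contains a rank-1 point if and only if $\mathcal{N}_\pi$ is a rank-1 net.
   Context: Points of $\mathrm{PG}(5,q)$ are identified with symmetric $3\times 3$ matrices via $(y_0,\dots,y_5)\leftrightarrow\begin{pmatrix} y_0&y_1&y_2\\ y_1&y_3&y_4\\ y_2&y_4&y_5\end{pmatrix}$, and the rank of a point is the rank of its matrix. Rank-1 points are the points of the Veronese surface, the image of $\nu:(u_0,u_1,u_2)\mapsto(u_0^2,u_0u_1,u_0u_2,u_1^2,u_1u_2,u_2^2)$. The hyperplane $a_{00}Y_0+a_{01}Y_1+a_{02}Y_2+a_{11}Y_3+a_{12}Y_4+a_{22}Y_5=0$ of $\mathrm{PG}(5,q)$ corresponds to the conic $a_{00}X^2+a_{01}XY+a_{02}XZ+a_{11}Y^2+a_{12}YZ+a_{22}Z^2=0$ of $\mathrm{PG}(2,q)$. The net of conics $\mathcal{N}_\pi$ associated with a plane $\pi$ is the 2-dimensional linear system of conics corresponding to the hyperplanes containing $\pi$. A net of conics has rank 1 if it contains at least one double line, i.e. a conic whose form is a nonzero scalar multiple of the square of a linear form over $\mathbb{F}_q$. *)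

(* Defs.v *)
From HB Require Import structures.
From mathcomp Require Import all_boot all_algebra.
From mathcomp Require Import mpoly.

Set Implicit Arguments.
Unset Strict Implicit.
Unset Printing Implicit Defensive.

Import GRing.Theory.
Local Open Scope ring_scope.

(* The Veronese map nu; it fixes the order of the six coordinates of PG(5,q)
   and of the six coefficients of a quadratic form. *)
Definition veronese (R : comNzRingType) (u : 'rV[R]_3) : 'rV[R]_6 :=
  let u0 := u 0 0 in let u1 := u 0 1 in let u2 := u 0 2 in
  \row_k [:: u0 ^+ 2; u0 * u1; u0 * u2; u1 ^+ 2; u1 * u2; u2 ^+ 2]`_k.

Section Correspondence.
Variable F : finFieldType.

Notation V6 := ('rV[F]_6).
Notation form d := (dhomog 3 F d).

(* A point of PG(5,q) is represented by any nonzero y : 'rV[F]_6. *)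
Definition sym_mx (y : V6) : 'M[F]_3 :=
  \matrix_(i < 3, j < 3)
    (nth [::] [:: [:: y 0 0; y 0 1; y 0 2];
                  [:: y 0 1; y 0 3; y 0 4];
                  [:: y 0 2; y 0 4; y 0 5]] i)`_j.

Lemma sym_mx_veronese (u : 'rV[F]_3) : sym_mx (veronese u) = u^T *m u.
Proof.
apply/matrixP => i j; rewrite !mxE big_ord1 !mxE.
have ordE (k l : 'I_3) : k = l :> nat -> u 0 k = u ord0 l.
  by move=> kl; congr (u _ _); apply: val_inj.
by case: i j => [[|[|[|i]]] lti] [[|[|[|j]]] ltj] //=; rewrite ?expr2;
  first [ congr (_ * _); exact: ordE
        | rewrite mulrC; congr (_ * _); exact: ordE ].
Qed.

(* Projective dimension 2 is vector space dimension 3. *)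
Definition plane := {U : {vspace V6} | \dim U == 3%N}.
Definition net_of_conics := {N : {vspace form 2} | \dim N == 3%N}.

Definition has_rank1_point (pi : plane) : Prop :=
  exists2 y : V6, y \in val pi & \rank (sym_mx y) = 1%N.

Definition hyperplane_eqn (a y : V6) : F^o := \sum_(k < 6) a 0 k * y 0 k.

Fact hyperplane_eqn_linear a : linear (hyperplane_eqn a).
Proof.
move=> c x y; rewrite /hyperplane_eqn scaler_sumr -big_split /=.
by apply: eq_bigr => k _; rewrite !mxE mulrDr mulrCA.
Qed.
HB.instance Definition _ a :=
  GRing.isLinear.Build F V6 F^o _ (hyperplane_eqn a) (hyperplane_eqn_linear a).

(* This is a hyperplane for a != 0, and the whole space for a = 0. *)
Definition hyperplane (a : V6) : {vspace V6} := lker (linfun (hyperplane_eqn a)).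

Definition conic_poly (a : V6) : {mpoly F[3]} :=
  \sum_(k < 6) a 0 k *: veronese (\row_i 'X_i) 0 k.

Fact conic_poly_homog a : conic_poly a \is 2.-homog.
Proof.
have X2 (i j : 'I_3) : ('X_i * 'X_j : {mpoly F[3]}) \is 2.-homog.
  by apply: (@dhomogM _ _ _ 1 _ 1); rewrite dhomogX; apply/eqP/mdeg1.
apply: rpred_sum => k _; apply: rpredZ; rewrite !mxE.
by case: (nat_of_ord k) => [|[|[|[|[|[|i]]]]]]; rewrite /= ?expr2 ?nth_nil ?rpred0.
Qed.

Definition conic (a : V6) : form 2 := DHomog (conic_poly_homog a).

Fact conic_linear : linear conic.
Proof.
move=> c x y; apply: val_inj => /=; rewrite /conic_poly.
rewrite scaler_sumr -big_split /=.
by apply: eq_bigr => k _; rewrite !mxE scalerDl scalerA.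
Qed.
HB.instance Definition _ :=
  GRing.isLinear.Build F V6 (form 2) _ conic conic_linear.

(* The linear system spanned by the conics of the hyperplanes through U. *)
Definition net_space (U : {vspace V6}) : {vspace form 2} :=
  (\sum_(a | (a != 0%R) && (U <= hyperplane a)%VS) <[conic a]>)%VS.

Definition annihilator (U : {vspace V6}) : {vspace V6} :=
  (\sum_(a | (U <= hyperplane a)%VS) <[a]>)%VS.

Lemma mem_hyperplane a y : (y \in hyperplane a) = (hyperplane_eqn a y == 0).
Proof. by rewrite memv_ker lfunE. Qed.

Lemma hyperplane_eqnC a y : hyperplane_eqn a y = hyperplane_eqn y a.
Proof. by apply: eq_bigr => k _; rewrite mulrC. Qed.

Lemma mem_annihilator U a : (a \in annihilator U) = (U <= hyperplane a)%VS.
Proof.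
apply/idP/idP => [|Ua]; last first.
  by apply: (subvP (sumv_sup a Ua (subvv _))); apply: memv_line.
case/memv_sumP => b Hb ->; apply/subvP => y Uy.
rewrite mem_hyperplane hyperplane_eqnC linear_sum big1 // => c Uc.
have /vlineP[k ->] := Hb c Uc; rewrite linearZ /= hyperplane_eqnC.
by move/subvP/(_ y Uy): Uc; rewrite mem_hyperplane => /eqP->; rewrite scaler0.
Qed.

Lemma dim_annihilator U : \dim (annihilator U) = (6 - \dim U)%N.
Proof.
have dimU : (\dim U <= 6)%N by have := dimvS (subvf U); rewrite dimvf.
pose B : 'M[F]_(\dim U, 6) := \matrix_i (vbasis U)`_i.
have frB : row_free B.
  apply/row_freeP; apply/row_freeP; rewrite -kermx_eq0; apply/eqP/row_matrixP => i.
  set c := row i _.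
  have cB : c *m B = 0 by apply/sub_kermxP; rewrite row_sub.
  have /freeP fU := basis_free (vbasisP U).
  rewrite row0; apply/rowP => j; rewrite [RHS]mxE; apply: (fU (c 0)).
  rewrite -[RHS]cB mulmx_sum_row; apply: eq_bigr => k _.
  by rewrite rowK.
pose f : V6 -> 'rV[F]_(\dim U) := mulmxr B^T.
pose g := linfun f.
have gE a : g a = a *m B^T by rewrite lfunE.
have kerE : lker g = annihilator U.
  apply/vspaceP => a; rewrite memv_ker gE mem_annihilator.
  have E i : (a *m B^T) 0 i = hyperplane_eqn a (vbasis U)`_i.
    by rewrite !mxE; apply: eq_bigr => k _; rewrite !mxE.
  apply/eqP/subvP => [a0 y Uy | Ua].
    rewrite (coord_vbasis Uy) memv_suml // => i _; apply: memvZ.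
    by rewrite mem_hyperplane -E a0 mxE.
  apply/rowP => i; rewrite E mxE; apply/eqP; rewrite -mem_hyperplane Ua //.
  by apply: vbasis_mem; rewrite mem_nth // size_tuple.
have limE : limg g = fullv.
  apply/vspaceP => c; rewrite memvf; apply/idP.
  have : (c <= B^T)%MS by apply: submx_full; rewrite /row_full mxrank_tr.
  by case/submxP => a ->; rewrite -gE memv_img // memvf.
have := limg_ker_dim g fullv; rewrite capfv kerE limE !dimvf /dim /=.
by rewrite !mul1n => dimE; apply/eqP; rewrite -(eqn_add2r (\dim U)) dimE subnK // dimU.
Qed.

Lemma annihilatorK : involutive annihilator.
Proof.
move=> U; apply/esym/eqP; rewrite eqEdim !dim_annihilator.
have dU : (\dim U <= 6)%N by have := dimvS (subvf U); rewrite dimvf.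
rewrite subKn // leqnn andbT; apply/subvP => y Uy.
rewrite mem_annihilator; apply/subvP => a; rewrite mem_annihilator => /subvP.
by move=> /(_ y Uy); rewrite !mem_hyperplane hyperplane_eqnC.
Qed.

Lemma net_spaceE U : net_space U = (linfun conic @: annihilator U)%VS.
Proof.
rewrite /annihilator limg_sum /net_space [RHS](bigID (fun a : V6 => a != 0)) /=.
rewrite [X in (_ + X)%VS]big1 ?addv0 => [|a /andP[_ /negPn/eqP->]].
  by apply: eq_big => [a | a _]; rewrite 1?andbC // limg_line lfunE.
by rewrite limg_line linear0.
Qed.

Lemma conic_inj : injective conic.
Proof.
pose mon (k : 'I_6) : 'X_{1..3} := nth 0%MM
  [:: U_(0%R) + U_(0%R); U_(0%R) + U_(1%R); U_(0%R) + U_(2%R); U_(1%R) + U_(1%R);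
      U_(1%R) + U_(2%R); U_(2%R) + U_(2%R)]%MM k.
have mon_inj : injective mon.
  move=> [i lti] [j ltj] E; apply: val_inj; move: E; rewrite /mon /=.
  move: i lti j ltj => [|[|[|[|[|[|i]]]]]] // _ [|[|[|[|[|[|j]]]]]] // _ /= E;
  have := (congr1 (fun m : 'X_{1..3} => m 0) E,
           congr1 (fun m : 'X_{1..3} => m 1) E,
           congr1 (fun m : 'X_{1..3} => m 2) E);
  by rewrite /= !mnmDE !mnm1E => -[[]].
have conicE a : conic_poly a = \sum_k a 0 k *: 'X_[mon k].
  apply: eq_bigr => -[k ltk] _; congr (_ *: _); rewrite !mxE /mon /=.
  by move: k ltk => [|[|[|[|[|[|k]]]]]] // _; rewrite /= mpolyXD ?expr2.
move=> a b /(congr1 val) /= Eab; apply/rowP => k.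
suff coefE c : (conic_poly c)@_(mon k) = c 0 k by rewrite -!coefE Eab.
rewrite conicE raddf_sum /= (bigD1 k) //= mcoeffZ mcoeffX eqxx mulr1.
rewrite big1 ?addr0 // => j /negPf nejk.
by rewrite mcoeffZ mcoeffX (inj_eq mon_inj) nejk mulr0.
Qed.

Lemma lker_conic : lker (linfun conic) == 0%VS.
Proof. by apply/lker0P => a b; rewrite !lfunE; apply: conic_inj. Qed.

Lemma mem_net_space U a : (conic a \in net_space U) = (U <= hyperplane a)%VS.
Proof.
rewrite net_spaceE -mem_annihilator; apply/memv_imgP/idP => [[b Ub]|Ua].
  by rewrite lfunE => /conic_inj->.
by exists a; rewrite ?lfunE.
Qed.

Fact dim_net_space (pi : plane) : \dim (net_space (val pi)) == 3%N.
Proof.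
rewrite net_spaceE limg_dim_eq ?dim_annihilator ?(eqP (valP pi)) //.
by rewrite (eqP lker_conic) capv0.
Qed.

Definition net_of (pi : plane) : net_of_conics :=
  Sub (net_space (val pi)) (dim_net_space pi).

Lemma net_of_bij : bijective net_of.
Proof.
have limE : limg (linfun conic) = fullv.
  apply/eqP; rewrite eqEdim subvf limg_dim_eq ?dimvf //.
  by rewrite (eqP lker_conic) capv0.
have preimK (U : {vspace V6}) : (linfun conic @^-1: (linfun conic @: U))%VS = U.
  apply/vspaceP => a; rewrite -memv_preim lfunE; apply/memv_imgP/idP => [[b Ub]|Ua].
    by rewrite lfunE => /conic_inj->.
  by exists a; rewrite ?lfunE.
have imK (N : {vspace form 2}) : (linfun conic @: (linfun conic @^-1: N))%VS = N.
  by rewrite lpreimK // limE subvf.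
have dimK (N : net_of_conics) :
    \dim (annihilator (linfun conic @^-1: val N)) == 3%N.
  have kerI : (linfun conic @^-1: val N :&: lker (linfun conic) = 0)%VS.
    by rewrite (eqP lker_conic) capv0.
  by rewrite dim_annihilator -(limg_dim_eq kerI) imK (eqP (valP N)).
exists (fun N => exist (fun U : {vspace V6} => \dim U == 3%N) _ (dimK N)) => [pi | N];
  apply: val_inj => /=.
  by rewrite net_spaceE preimK annihilatorK.
by rewrite net_spaceE annihilatorK imK.
Qed.

(* A conic is given by a nonzero form, hence l != 0. *)
Definition double_line (f : form 2) : Prop :=
  exists (c : F) (l : form 1),
    [/\ c != 0, l != 0 & (f : {mpoly F[3]}) = c *: (l : {mpoly F[3]}) ^+ 2].

Definition rank1_net (N : net_of_conics) : Prop :=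
  exists2 f : form 2, f \in val N & double_line f.

End Correspondence.

(* Main.v *)
Require Import Defs.
From mathcomp Require Import all_boot all_algebra.
From mathcomp Require Import mpoly.

(** A conic of the net of [pi] vanishes at every [u] whose Veronese image lies
    in [pi], because its value at [u] is the value of the corresponding
    hyperplane equation at [veronese u].  The rank-1 points of [pi] are thus
    base points of the net.  Let [pi] be spanned by the Veronese images of the
    three vertices of the triangle of reference: it has rank-1 points, and the
    conics of its net, spanned by XY, XZ and YZ, all pass through the three
    vertices.  The vertices are not collinear, so no double line passes through
    all of them, and the net does not have rank 1. *)

Section TrianglePlane.
Import GRing.Theory.
Local Open Scope ring_scope.
Set Implicit Arguments.
Unset Strict Implicit.

Variable F : finFieldType.

Lemma meval_conic (a : 'rV[F]_6) (u : 'rV[F]_3) :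
  (conic_poly a).@[u 0] = hyperplane_eqn a (veronese u).
Proof.
rewrite /conic_poly raddf_sum /=; apply: eq_bigr => k _; rewrite mevalZ !mxE.
congr (_ * _); case: k => [[|[|[|[|[|[|k]]]]]] ltk] //=;
  by rewrite ?expr2 rmorphM /= !mevalXU.
Qed.

(** The rank-1 points of a plane are base points of its net. *)
Lemma net_base_point (U : {vspace 'rV[F]_6}) (f : dhomog 3 F 2) (u : 'rV[F]_3) :
  f \in net_space U -> veronese u \in U -> (f : {mpoly F[3]}).@[u 0] = 0.
Proof.
rewrite net_spaceE => /memv_imgP[a]; rewrite mem_annihilator lfunE => /subvP Ua ->.
by move=> /Ua; rewrite mem_hyperplane /= meval_conic => /eqP.
Qed.

Lemma rank_veronese (u : 'rV[F]_3) : u != 0 -> \rank (sym_mx (veronese u)) = 1%N.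
Proof.
move=> u_neq0; rewrite sym_mx_veronese mxrankMfree ?mxrank_tr ?rank_rV ?u_neq0 //.
by rewrite /row_free rank_rV u_neq0.
Qed.

Lemma dhomog1E n (R : comNzRingType) (l : {mpoly R[n]}) :
  l \is 1.-homog -> l = \sum_i l@_U_(i) *: 'X_i.
Proof.
move=> hl; apply/mpolyP => m; rewrite raddf_sum /=.
have [/eqP|m1] := eqVneq (mdeg m) 1%N; last first.
  rewrite (dhomog_nemf_coeff hl m1) big1 // => i _.
  rewrite mcoeffZ mcoeffX; case: eqP => [E|]; rewrite ?mulr0 //.
  by rewrite -E mdeg1 eqxx in m1.
case/mdeg1P => i /eqP ->; rewrite (bigD1 i) //= mcoeffZ mcoeffX eqxx mulr1.
rewrite big1 ?addr0 // => j /negPf ji.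
by rewrite mcoeffZ mcoeffX eq_mnm1 ji mulr0.
Qed.

(** The value at the i-th vertex of the triangle of reference is the coefficient
    of the i-th variable.  For three variables this says that the vertices are
    not collinear. *)
Lemma linear_form_vertices_eq0 n (R : comNzRingType) (l : {mpoly R[n]}) :
  l \is 1.-homog -> (forall i, l.@[(delta_mx 0 i : 'rV_n) 0] = 0) -> l = 0.
Proof.
move=> /dhomog1E lE l0; rewrite lE big1 // => i _.
have := l0 i; rewrite {1}lE raddf_sum /= (bigD1 i) //= mevalZ mevalXU.
rewrite mxE !eqxx mulr1 big1 ?addr0 => [-> | j /negPf ji]; first by rewrite scale0r.
by rewrite mevalZ mevalXU mxE ji andbF mulr0.
Qed.

Definition veronese_triangle : 3.-tuple 'rV[F]_6 :=
  [tuple veronese (delta_mx 0 i) | i < 3].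

Lemma veronese_triangle_free : free veronese_triangle.
Proof.
apply/freeP => k.
under eq_bigr => i _ do rewrite -tnth_nth tnth_mktuple.
move=> /rowP k0.
(* The coordinates Y_0, Y_3 and Y_5 of veronese u are the squares of the entries
   of u, and the i-th vertex is the only one whose i-th entry is nonzero. *)
move=> i; have := k0 (nth 0 [:: 0; 3; 5] i); rewrite !big_ord_recl big_ord0 !mxE.
case: i => [[|[|[|i]]] lti] //=;
  rewrite ?expr2 ?(mulr0, mulr1, addr0, add0r) => kE;
  by rewrite -[RHS]kE; congr (k _); apply: val_inj.
Qed.

Fact dim_triangle_plane : \dim <<veronese_triangle>> == 3%N.
Proof. by have := veronese_triangle_free; rewrite /free size_tuple. Qed.

Definition triangle_plane : plane F :=
  exist (fun U : {vspace 'rV[F]_6} => \dim U == 3%N) _ dim_triangle_plane.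

Lemma veronese_vertex_in_triangle_plane i :
  veronese (delta_mx 0 i) \in val triangle_plane.
Proof. by apply/memv_span/mapP; exists i; rewrite ?mem_enum. Qed.

Lemma triangle_plane_rank1_point : has_rank1_point triangle_plane.
Proof.
exists (veronese (delta_mx 0 0)); first exact: veronese_vertex_in_triangle_plane.
apply: rank_veronese; apply/eqP => /rowP/(_ 0)/eqP.
by rewrite !mxE /= oner_eq0.
Qed.

Lemma triangle_net_not_rank1 : ~ rank1_net (net_of triangle_plane).
Proof.
case=> f Nf [c [l [c_neq0 /eqP l_neq0 fE]]]; apply: l_neq0; apply: val_inj => /=.
apply: linear_form_vertices_eq0 => [|i]; first exact: (valP l).
have := net_base_point Nf (veronese_vertex_in_triangle_plane i).
rewrite fE mevalZ rmorphXn /= => /eqP.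
by rewrite mulf_eq0 (negPf c_neq0) expf_eq0 /= => /eqP.
Qed.

End TrianglePlane.

Theorem corollary4p1 (F : finFieldType) (q : nat) (hq : #|F| = q)
    (q_even : ~~ odd q) :
  ~ (forall pi : plane F, has_rank1_point pi <-> rank1_net (net_of pi)).
Proof.
move=> /(_ (triangle_plane F)) [/(_ (triangle_plane_rank1_point F))].
by move=> /triangle_net_not_rank1.
Qed.
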